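(* Let $Q$ be a real symmetric positive semidefinite $d\times d$ matrix, let $f(x)=\tfrac12 x^\top Qx$ on $\mathbb{R}^d$, and let $L=\lambda_{\max}(Q)$ be the largest eigenvalue of $Q$ (with $L=0$ allowed). (1) For any $x_0\in\mathbb{R}^d$ and any stepsize $\eta\ge0$ with $\eta\lambda_i\in[0,2]$ for every eigenvalue $\lambda_i$ of $Q$ (in particular, any $\eta\in[0,2/L]$ when $L>0$), the gradient descent iterates $x_{n+1}=x_n-\eta\nabla f(x_n)$, $n\ge0$, are such that the sequence $n\mapsto f(x_n)$ is nonincreasing and convex; equivalently, with $\Delta_n:=f(x_n)-f(x_{n+1})$, one has $\Delta_n\ge0$ and $\Delta_{n+1}\le\Delta_n$ for all $n\ge0$. (2) The range is exact: if $L>0$ and $\eta>2/L$, then there is an initialization $x_0\in\mathbb{R}^d$ for which the sequence $\{f(x_n)\}_{n\ge0}$ generated by the same iteration diverges.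
   Context: A real sequence $\{a_n\}_{n\ge0}$ is called convex if $a_{n+1}-a_n\le a_{n+2}-a_{n+1}$ for all $n\ge0$. *)

(* Defs.v *)
From HB Require Import structures.
From mathcomp Require Export all_boot all_order all_algebra.
From mathcomp Require Export all_classical all_reals all_analysis.
Set Implicit Arguments.
Unset Strict Implicit.
Unset Printing Implicit Defensive.
Export Order.TTheory GRing.Theory Num.Theory.
Export numFieldNormedType.Exports.
Local Open Scope classical_set_scope.
Local Open Scope ring_scope.

Definition convex_seq (R : realType) (a : nat -> R) : Prop :=
  forall n : nat, a n.+1 - a n <= a n.+2 - a n.+1.

Definition posSemidef (R : realType) (d : nat) (Q : 'M[R]_d) : Prop :=
  forall x : 'cV[R]_d, 0 <= (x^T *m Q *m x) 0 0.

Definition largest_eigenvalue (R : realType) (d : nat) (Q : 'M[R]_d) (L : R)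
    : Prop :=
  eigenvalue Q L /\ forall a : R, eigenvalue Q a -> a <= L.

Definition quad (R : realType) (d : nat) (Q : 'M[R]_d) (x : 'cV[R]_d) : R :=
  2^-1 * (x^T *m Q *m x) 0 0.

Definition gradient (R : realType) (d : nat) (f : 'cV[R]_d -> R)
    (x : 'cV[R]_d) : 'cV[R]_d :=
  \col_i 'D_(delta_mx i 0) f x.

Definition gd (R : realType) (d : nat) (f : 'cV[R]_d -> R) (eta : R)
    (x0 : 'cV[R]_d) (n : nat) : 'cV[R]_d :=
  iter n (fun x => x - eta *: gradient f x) x0.

(* Main.v *)
Require Import Defs.
From mathcomp Require Import complex spectral ring lra.
Set Implicit Arguments.
Unset Strict Implicit.
Unset Printing Implicit Defensive.
Local Open Scope classical_set_scope.
Local Open Scope ring_scope.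

(** Gradient descent acts by [M = 1 - eta Q], which commutes with [Q].  Hence
    [Delta_n = (eta / 2) g^T (2 - eta Q) g] with [g = Q x_n], nonnegative as soon
    as the eigenvalues of [eta Q] are at most 2 (Rayleigh bound), and
    [Delta_n - Delta_(n+1) = eta^2 f(w)] with [w = (2 - eta Q) g], nonnegative
    because [Q] is positive semidefinite.  For sharpness start at an eigenvector
    for [L]: then [f(x_n)] is geometric of ratio [(1 - eta L)^2 > 1]. *)

Definition dot (R : realType) (d : nat) (x y : 'cV[R]_d) : R := (x^T *m y) 0 0.

Section Dot.
Variables (R : realType) (d : nat).
Implicit Types (x y z : 'cV[R]_d) (Q : 'M[R]_d).

Lemma dotE x y : dot x y = \sum_i x i 0 * y i 0.
Proof. by rewrite /dot mxE; apply: eq_bigr => i _; rewrite mxE. Qed.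

Lemma dotC x y : dot x y = dot y x.
Proof. by rewrite !dotE; apply: eq_bigr => i _; rewrite mulrC. Qed.

Lemma dotDl x y z : dot (x + y) z = dot x z + dot y z.
Proof. by rewrite /dot linearD mulmxDl mxE. Qed.

Lemma dotZl a x y : dot (a *: x) y = a * dot x y.
Proof. by rewrite /dot linearZ -scalemxAl mxE. Qed.

Lemma dotNl x y : dot (- x) y = - dot x y.
Proof. by rewrite -scaleN1r dotZl mulN1r. Qed.

Lemma dotDr x y z : dot x (y + z) = dot x y + dot x z.
Proof. by rewrite dotC dotDl !(dotC x). Qed.

Lemma dotZr a x y : dot x (a *: y) = a * dot x y.
Proof. by rewrite dotC dotZl dotC. Qed.

Lemma dotNr x y : dot x (- y) = - dot x y.
Proof. by rewrite dotC dotNl dotC. Qed.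

Definition dotL := (dotDl, dotDr, dotNl, dotNr, dotZl, dotZr).

Lemma dot_ge0 x : 0 <= dot x x.
Proof. by rewrite dotE; apply: sumr_ge0 => i _; rewrite -expr2 sqr_ge0. Qed.

Lemma dot_gt0 x : x != 0 -> 0 < dot x x.
Proof.
move=> x0; rewrite lt_def dot_ge0 andbT; apply: contra x0 => /eqP.
rewrite dotE => /eqP; rewrite psumr_eq0 => [/allP h|i _]; last first.
  by rewrite -expr2 sqr_ge0.
apply/eqP/colP => i; rewrite mxE; apply/eqP.
by have := h i (mem_index_enum _); rewrite mulf_eq0 orbb.
Qed.

Lemma symmetricmx_trmx Q : Q \is symmetricmx -> Q^T = Q.
Proof. by move=> /is_hermitianmxP; rewrite expr0 scale1r map_mx_id. Qed.

Lemma dot_mulmx_sym Q x y : Q \is symmetricmx -> dot (Q *m x) y = dot x (Q *m y).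
Proof. by move=> /symmetricmx_trmx QT; rewrite /dot trmx_mul QT mulmxA. Qed.

Lemma quadE Q x : quad Q x = 2^-1 * dot x (Q *m x).
Proof. by rewrite /quad /dot mulmxA. Qed.

(** For [h != 0] the difference quotient along [v] is exactly affine in [h], with constant term
    [dot v (Q *m x)]: symmetry merges the two cross terms. *)
Lemma gradient_quad Q x : Q \is symmetricmx -> gradient (quad Q) x = Q *m x.
Proof.
move=> Qsym; apply/colP => i; rewrite mxE /derive.
set v := delta_mx i 0.
have -> : (Q *m x) i 0 = dot v (Q *m x).
  rewrite dotE (bigD1 i)//= big1 => [|j /negbTE ji].
    by rewrite !mxE !eqxx mul1r addr0.
  by rewrite mxE ji mul0r.
apply: (@cvg_lim R^o) => //.
have : (fun h : R => dot v (Q *m x) + h * (2^-1 * dot v (Q *m v))) @ 0^' -->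
    dot v (Q *m x) + 0 * (2^-1 * dot v (Q *m v)).
  apply: cvgD; first exact: cvg_cst.
  by apply: cvgM; [exact: nbhs_dnbhs | exact: cvg_cst].
rewrite mul0r addr0; apply: cvg_trans; apply: near_eq_cvg.
near=> h.
have h0 : h != 0 by near: h; exact: nbhs_dnbhs_neq.
rewrite /= /GRing.scale/= !quadE mulmxDr -scalemxAr !dotL.
by rewrite -(dot_mulmx_sym x v Qsym) (dotC _ v); field.
Unshelve. all: by end_near. Qed.

(* [Q] is unitarily diagonalized over [R[i]]; its spectrum there is real, so its
   complex eigenvalues are eigenvalues over [R]. *)
Lemma dot_mulmx_le_eigen Q (c : R) x : Q \is symmetricmx ->
  (forall a, eigenvalue Q a -> a <= c) -> dot x (Q *m x) <= c * dot x x.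
Proof.
move=> Qsym Qc; pose f : {rmorphism R -> R[i]} := real_complex R.
pose A := map_mx f Q; pose y := map_mx f x.
have fconj m n (M : 'M[R]_(m, n)) : map_mx Num.conj (map_mx f M) = map_mx f M.
  apply/matrixP => i j; rewrite !mxE; apply: conj_Creal.
  by rewrite complex_real.
have Aherm : A \is hermsymmx.
  apply/is_hermitianmxP; rewrite expr0 scale1r -map_trmx fconj.
  by rewrite map_trmx symmetricmx_trmx.
have /orthomx_spectralP := hermitian_normalmx Aherm.
rewrite /=; set P := spectralmx A; set D := spectral_diag A => AE.
have PU : P \is unitarymx by exact: spectral_unitarymx.
have Punit : P \in unitmx by exact: spectral_unit.
pose z := P *m y.
(* [y] is real, so conjugation only affects [P], whose conjugate transpose is its inverse. *)
have zT : (map_mx Num.conj z)^T = y^T *m invmx P.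
  by rewrite invmx_unitary// /z map_mxM fconj trmx_mul !map_trmx.
have Dle i : D 0 i <= f c.
  have /mxOverP/(_ 0 i)/complex_realP[r Dr] := hermitian_spectral_diag_real Aherm.
  rewrite -/D in Dr; rewrite Dr lecR; apply: Qc.
  (* Since [A] is [invmx P *m diag_mx D *m P], the rows of [P] are left eigenvectors of [A]; none
     vanishes because [P] is invertible. *)
  rewrite -(eigenvalue_map f) -/A; apply/eigenvalueP; exists (row i P).
    rewrite -row_mul AE !mulmxA mulmxV// mul1mx row_mul row_diag_mx.
    by rewrite -scalemxAl -rowE Dr.
  apply/eqP => Pi0; have := mulmxV Punit => /(congr1 (row i)).
  rewrite row_mul Pi0 mul0mx => /rowP/(_ i)/eqP.
  by rewrite !mxE eqxx eq_sym oner_eq0.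
(* In the coordinates [z] both forms are diagonal, so they can be compared term by term. *)
have fQ : f (dot x (Q *m x)) = \sum_i D 0 i * `|z i 0| ^+ 2.
  have -> : f (dot x (Q *m x)) = ((map_mx Num.conj z)^T *m (diag_mx D *m z)) 0 0.
    by rewrite zT /z !mulmxA -2!(mulmxA y^T) -AE map_trmx -!map_mxM mxE /dot mulmxA.
  rewrite mxE; apply: eq_bigr => i _; rewrite mul_diag_mx !mxE normCK; ring.
have fx : f (dot x x) = \sum_i `|z i 0| ^+ 2.
  have -> : f (dot x x) = ((map_mx Num.conj z)^T *m z) 0 0.
    by rewrite zT /z mulmxA mulmxKV// map_trmx -map_mxM mxE.
  by rewrite mxE; apply: eq_bigr => i _; rewrite !mxE normCK mulrC.
rewrite -lecR -/(f _) -[X in _ <= X]/(f _) rmorphM fQ fx mulr_sumr.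
by apply: ler_sum => i _; rewrite ler_wpM2r// exprn_ge0.
Qed.

End Dot.

(** Shifting the index shows that a limit [l] satisfies [l = q * l], so [l = 0]; but every term is
    at least [c > 0]. *)
Lemma not_cvg_geometric (R : realType) (c q : R) :
  0 < c -> 1 < q -> ~ cvgn (fun n => c * q ^+ n).
Proof.
move=> c0 q1 cv; pose u n : R := c * q ^+ n.
have u1 : u n.+1 @[n --> \oo] --> limn u by rewrite cvg_shiftS.
have u2 : u n.+1 @[n --> \oo] --> q * limn u.
  rewrite (_ : (fun n => u n.+1) = (fun n => q * u n)); last first.
    by apply/funext => n; rewrite /u exprS; ring.
  by apply: cvgMr.
have lE : limn u = q * limn u by rewrite -[LHS](cvg_lim _ u1)// (cvg_lim _ u2).
have cl : c <= limn u.
  apply: limr_ge => //; apply: nearW => n.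
  by rewrite /u ler_peMr ?exprn_ege1// ltW.
nra.
Qed.

Section GradientDescent.
Variables (R : realType) (d : nat) (Q : 'M[R]_d).
Hypothesis Qsym : Q \is symmetricmx.

Lemma gdS eta x0 n : gd (quad Q) eta x0 n.+1 =
  gd (quad Q) eta x0 n - eta *: (Q *m gd (quad Q) eta x0 n).
Proof. by rewrite /gd iterS gradient_quad. Qed.

Lemma quad_decrease eta x :
  quad Q x - quad Q (x - eta *: (Q *m x)) =
  eta / 2 * (2 * dot (Q *m x) (Q *m x) - eta * dot (Q *m x) (Q *m (Q *m x))).
Proof.
rewrite !quadE mulmxBr -scalemxAr !dotL -(dot_mulmx_sym x (Q *m x) Qsym).
by rewrite dot_mulmx_sym//; field.
Qed.

Lemma quad_second_difference eta (x : 'cV[R]_d) (y := x - eta *: (Q *m x))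
    (z := y - eta *: (Q *m y)) (w := 2 *: (Q *m x) - eta *: (Q *m (Q *m x))) :
  (quad Q x - quad Q y) - (quad Q y - quad Q z) = eta ^+ 2 * quad Q w.
Proof.
rewrite /z !quad_decrease quadE /w /y !(mulmxBr, =^~ scalemxAr, dotL).
set g := Q *m x; set h := Q *m g; set k := Q *m h.
(* With this relation and [dot h g = dot g h], the claim is a polynomial identity in the remaining
   inner products. *)
have -> : dot g k = dot h h by rewrite -(dot_mulmx_sym g h Qsym).
by rewrite (dotC h g); field.
Qed.

Lemma gd_eigenvector eta a x0 n : Q *m x0 = a *: x0 ->
  gd (quad Q) eta x0 n = (1 - eta * a) ^+ n *: x0.
Proof.
move=> Qx; elim: n => [|n IHn]; first by rewrite expr0 scale1r.
rewrite gdS IHn -scalemxAr Qx !scalerA -scalerBl exprS; congr (_ *: _); ring.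
Qed.

End GradientDescent.

Theorem proposition4p1 (R : realType) (d : nat) (Q : 'M[R]_d) (L : R)
    (Qsym : Q \is symmetricmx) (Qpsd : posSemidef Q)
    (QL : largest_eigenvalue Q L) :
  (* (1) *)
  (forall (x0 : 'cV[R]_d) (eta : R), 0 <= eta ->
     (forall lambda : R, eigenvalue Q lambda -> 0 <= eta * lambda <= 2) ->
     let u := fun n : nat => quad Q (gd (quad Q) eta x0 n) in
     let Delta := fun n : nat => u n - u n.+1 in
     [/\ nonincreasing_seq u,
         convex_seq u &
         forall n : nat, 0 <= Delta n /\ Delta n.+1 <= Delta n]) /\
  (* the parenthetical special case of (1) *)
  (0 < L -> forall eta : R, 0 <= eta <= 2 / L ->
     forall lambda : R, eigenvalue Q lambda -> 0 <= eta * lambda <= 2) /\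
  (* (2) *)
  (0 < L -> forall eta : R, 2 / L < eta ->
     exists x0 : 'cV[R]_d,
       ~ cvgn (fun n : nat => quad Q (gd (quad Q) eta x0 n))).
Proof.
have [[/eigenvalueP[v vQ v0]] Lmax] := QL.
split; [|split].
- move=> x0 eta eta0 etaQ u Delta.
  have D0 n : 0 <= Delta n.
    rewrite /Delta /u gdS// quad_decrease//.
    apply: mulr_ge0; first by rewrite divr_ge0.
    set g := Q *m _; rewrite subr_ge0.
    (* The Rayleigh bound is applied with constant [2 / eta], so [eta = 0] is treated apart. *)
    have [->|etaN0] := eqVneq eta 0; first by rewrite mul0r mulr_ge0 ?dot_ge0.
    have eta_gt0 : 0 < eta by rewrite lt_def etaN0.
    have : dot g (Q *m g) <= 2 / eta * dot g g.
      apply: dot_mulmx_le_eigen => // a /etaQ/andP[_].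
      by rewrite ler_pdivlMr// mulrC.
    move=> /(ler_wpM2l eta0).
    by rewrite (mulrA eta (2 / _)) (mulrC eta (2 / _)) divfK.
  have D1 n : Delta n.+1 <= Delta n.
    rewrite -subr_ge0 /Delta /u !gdS// quad_second_difference//.
    by apply: mulr_ge0; rewrite ?sqr_ge0// /quad mulr_ge0// ?invr_ge0.
  split=> //.
  + by apply/nonincreasing_seqP => n; rewrite -subr_ge0; exact: D0.
  + by move=> n; have := D1 n; rewrite /Delta; lra.
- move=> L0 eta /andP[eta0]; rewrite ler_pdivlMr// => etaL lambda lambdaE.
  have lambda_le := Lmax _ lambdaE.
  (* Testing semidefiniteness on an eigenvector gives [lambda * dot w^T w^T >= 0], hence
     [lambda >= 0]. *)
  have [w wQ w0] := eigenvalueP lambdaE.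
  have wT0 : w^T != 0 by rewrite trmx_eq0.
  have lambda0 : 0 <= lambda.
    have := Qpsd w^T; rewrite trmxK wQ -scalemxAl mxE.
    have := dot_gt0 wT0; rewrite /dot trmxK => ww.
    by rewrite pmulr_lge0.
  by rewrite mulr_ge0//= (le_trans _ etaL)// ler_wpM2l.
- move=> L0 eta; rewrite ltr_pdivrMr// => etaL.
  (* [eigenvalue] provides a row eigenvector; by symmetry of [Q] its transpose is a column
     eigenvector. *)
  exists v^T.
  have Qv : Q *m v^T = L *: v^T.
    by rewrite -{1}(symmetricmx_trmx Qsym) -trmx_mul vQ linearZ.
  have vT0 : v^T != 0 by rewrite trmx_eq0.
  rewrite (_ : (fun n => _) =
      (fun n => (2^-1 * (L * dot v^T v^T)) * ((1 - eta * L) ^+ 2) ^+ n)).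
    (* The ratio exceeds 1 because [eta * L > 2] makes [1 - eta * L < -1]. *)
    apply: not_cvg_geometric; last nra.
    by rewrite !mulr_gt0// ?invr_gt0// dot_gt0.
  apply/funext => n; rewrite (gd_eigenvector Qsym _ _ Qv) quadE -scalemxAr Qv.
  by rewrite !dotL exprAC expr2; ring.
Qed.
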